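(* If $d\in\mathbb{N}$, $k\in\{0,\ldots,d-1\}$, $s>k$, and $0<\alpha\le1$, then there exists a constant $c=c(d,k,s,\alpha)>0$ so that for every measure $\mu$ on $\mathbb{R}^d$ we have $$\limsup_{r\downarrow0}\ \inf_{\theta\in S^{d-1},\ V\in G(d,d-k)}\frac{\mu\bigl(X(x,r,V,\alpha)\setminus H(x,\theta,\alpha)\bigr)}{\mu\bigl(B(x,r)\bigr)}>c$$ for $\mu$-almost all $x\in\mathbb{R}^d$ that satisfy $\overline{\dim}_{\mathrm{loc}}(\mu,x)>s$.
   Context: A measure on $\mathbb{R}^d$ means a nontrivial Borel regular outer measure defined on all subsets of $\mathbb{R}^d$ such that bounded sets have finite measure. $B(x,r)$ is the closed ball. The upper local dimension is $\overline{\dim}_{\mathrm{loc}}(\mu,x)=\limsup_{r\downarrow0}\log\mu(B(x,r))/\log r$. $G(d,n)$ is the Grassmann manifold of all $n$-dimensional linear subspaces of $\mathbb{R}^d$ and $S^{d-1}=\{y\in\mathbb{R}^d:|y|=1\}$. For $0<\alpha\le1$, $V\in G(d,d-k)$, $\theta\in S^{d-1}$, $x\in\mathbb{R}^d$ and $r>0$, $$X(x,r,V,\alpha)=\{y\in B(x,r):\operatorname{dist}(y-x,V)<\alpha|y-x|\},\qquad H(x,\theta,\alpha)=\{y\in\mathbb{R}^d:(y-x)\cdot\theta>\alpha|y-x|\}.$$ The constant $c$ depends only on $d,k,s,\alpha$. *)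

(* Defs.v *)
From HB Require Import structures.
From mathcomp Require Import all_boot all_order all_algebra.
From mathcomp Require Import all_classical all_reals all_analysis.

Set Implicit Arguments.
Unset Strict Implicit.
Unset Printing Implicit Defensive.
Import Order.TTheory GRing.Theory Num.Theory.
Import numFieldNormedType.Exports.

Local Open Scope classical_set_scope.
Local Open Scope ring_scope.

(* The library norm on 'rV[R]_d is the sup norm; it induces the usual topology
   and the usual bounded sets, so [open] and [bounded_set] below are the
   library's own, but every metric notion is built on the Euclidean norm. *)
Definition dotp (R : realType) (d : nat) (u v : 'rV[R]_d) : R :=
  \sum_(i < d) u ord0 i * v ord0 i.

Definition enorm (R : realType) (d : nat) (u : 'rV[R]_d) : R :=
  Num.sqrt (dotp u u).

Definition eball (R : realType) (d : nat) (x : 'rV[R]_d) (r : R) :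
    set 'rV[R]_d :=
  [set y | enorm (y - x) <= r].

Definition unit_sphere (R : realType) (d : nat) : set 'rV[R]_d :=
  [set y | enorm y = 1].

Definition grassmannian (R : realType) (d n : nat) : set {vspace 'rV[R]_d} :=
  [set V | \dim V = n].

Definition dist_subspace (R : realType) (d : nat) (u : 'rV[R]_d)
    (V : {vspace 'rV[R]_d}) : R :=
  inf [set enorm (u - v) | v in [set v | v \in V]].

Definition cone (R : realType) (d : nat) (x : 'rV[R]_d) (r : R)
    (V : {vspace 'rV[R]_d}) (alpha : R) : set 'rV[R]_d :=
  [set y | eball x r y /\ dist_subspace (y - x) V < alpha * enorm (y - x)].

Definition half_cone (R : realType) (d : nat) (x theta : 'rV[R]_d)
    (alpha : R) : set 'rV[R]_d :=
  [set y | dotp (y - x) theta > alpha * enorm (y - x)].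

Definition borel_sets (R : realType) (d : nat) : set (set 'rV[R]_d) :=
  <<s [set A : set 'rV[R]_d | open A] >>.

Record borel_regular (R : realType) (d : nat)
    (mu : {outer_measure set 'rV[R]_d -> \bar R}) : Prop := BorelRegular {
  borel_caratheodory : @borel_sets R d `<=` mu.-caratheodory;
  borel_hull : forall A : set 'rV[R]_d,
    exists2 B, borel_sets B & A `<=` B /\ mu B = mu A }.

Record is_measure_on_Rd (R : realType) (d : nat)
    (mu : {outer_measure set 'rV[R]_d -> \bar R}) : Prop := IsMeasureOnRd {
  measure_nontrivial : (0 < mu setT)%E;
  measure_borel_regular : borel_regular mu;
  measure_bounded_fin : forall A : set 'rV[R]_d,
    bounded_set A -> (mu A < +oo)%E }.

(* mu is defined on all sets, so no measurability of P is required. *)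
Definition almost_all (R : realType) (d : nat)
    (mu : {outer_measure set 'rV[R]_d -> \bar R}) (P : 'rV[R]_d -> Prop) :=
  mu (~` [set x | P x]) = 0%E.

(* If a small ball has measure 0 then lne 0 = -oo and the quotient is +oo. *)
Definition upper_local_dim (R : realType) (d : nat)
    (mu : {outer_measure set 'rV[R]_d -> \bar R}) (x : 'rV[R]_d) : \bar R :=
  limf_esup (fun r : R => lne (mu (eball x r)) / (ln r)%:E)%E 0^'+.

(* In \bar R one has 0 / 0 = 0; this value only matters off the support of mu,
   which is a mu-null set. *)
Definition cone_ratio (R : realType) (d : nat)
    (mu : {outer_measure set 'rV[R]_d -> \bar R}) (x : 'rV[R]_d)
    (alpha r : R) (theta : 'rV[R]_d) (V : {vspace 'rV[R]_d}) : \bar R :=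
  (mu (cone x r V alpha `\` half_cone x theta alpha) / mu (eball x r))%E.

(* Main.v *)
Require Import Defs.
From HB Require Import structures.
From mathcomp Require Import all_boot all_order all_algebra.
From mathcomp Require Import all_classical all_reals all_analysis.
From mathcomp Require Import ring lra zify.

Set Implicit Arguments.
Unset Strict Implicit.
Unset Printing Implicit Defensive.
Import Order.TTheory GRing.Theory Num.Theory.
Import numFieldNormedType.Exports.

Local Open Scope classical_set_scope.
Local Open Scope ring_scope.

(** Suppose that at every small scale r some V and theta make the punctured
    cone X(x,r,V,alpha) \ H(x,theta,alpha) carry at most c mu(B(x,r)), for all
    x in a set E of diameter about sigma. Cut E into about m^d pieces of
    diameter about sigma/m, pick a point y_i in each nonempty piece, and
    compare the masses w_i = mu(B(y_i, 4d sigma/m)) with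
    w = mu(B(x0, 4d sigma)), x0 in E.

    Only C m^k pieces can be heavy, meaning w_i > c w. Indeed, if i and j are
    both heavy, the ball around y_j is too heavy to fit in the punctured cone
    at y_i, and conversely. So, up to errors of order sigma/m, each of the two
    points is outside the cone X of the other or inside its half cone H. If
    the two points use the same V and theta, they cannot both be in the half
    cone of the other, since y_j - y_i and y_i - y_j are opposite; and when one
    is outside the cone of the other, the projections of y_i and y_j to the
    k-dimensional orthogonal complement of V are far apart, unless y_i and y_j
    are themselves within O(sigma/m). There are boundedly many V and theta up
    to a small error, and O(m^k) separated positions in the k-dimensional
    complement ([few_mutually_unseen], [few_heavy_pieces]).

    For 0 < q < 1 the light pieces are harmless: they number about m^d and each
    contributes at most (c w)^q, so a small c gives
    sum_i w_i^q <= (C + 1) m^k w^q ([piece_power_sum]). Iterating j times and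
    using mu(P) = mu(P)^(1-q) mu(P)^q on the final pieces, the set of points
    x in E with mu(B(x, 4d sigma/m^j)) < lambda has measure at most
    lambda^(1-q) ((C + 1) m^k)^j w^q ([sparse_points_le]). With lambda of
    order m^(-js) this is summable in j once s(1-q) > k and m is large, and by
    Borel-Cantelli almost every point of E satisfies mu(B(x,r)) >= r^s for all
    small r ([avoids_decays_null]), which contradicts an upper local dimension
    larger than s.

    Masses are measured on overlapping balls centred in E, rather than on
    disjoint cubes, so that all the balls met when cutting a piece, including
    those that truncate the cones, lie in the single ball B(x0, 4d sigma), and
    the induction closes with the masses of these balls alone. *)

(** * Euclidean norm and scalar product *)

Lemma dotpC (R : realType) d (u v : 'rV[R]_d) : dotp u v = dotp v u.
Proof. by apply: eq_bigr => i _; rewrite mulrC. Qed.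

Lemma dotpDl (R : realType) d (u v w : 'rV[R]_d) :
  dotp (u + v) w = dotp u w + dotp v w.
Proof.
by rewrite /dotp -big_split; apply: eq_bigr => i _; rewrite mxE mulrDl.
Qed.

Lemma dotpZl (R : realType) d a (u w : 'rV[R]_d) :
  dotp (a *: u) w = a * dotp u w.
Proof.
by rewrite /dotp mulr_sumr; apply: eq_bigr => i _; rewrite mxE mulrA.
Qed.

Lemma dotpNl (R : realType) d (u w : 'rV[R]_d) : dotp (- u) w = - dotp u w.
Proof. by rewrite -scaleN1r dotpZl mulN1r. Qed.

Lemma dotpBl (R : realType) d (u v w : 'rV[R]_d) :
  dotp (u - v) w = dotp u w - dotp v w.
Proof. by rewrite dotpDl dotpNl. Qed.

Lemma dotpBr (R : realType) d (u v w : 'rV[R]_d) :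
  dotp w (u - v) = dotp w u - dotp w v.
Proof. by rewrite dotpC dotpBl !(dotpC w). Qed.

Lemma dotp_ge0 (R : realType) d (u : 'rV[R]_d) : 0 <= dotp u u.
Proof. by apply: sumr_ge0 => i _; rewrite -expr2 sqr_ge0. Qed.

Lemma dotp_eq0 (R : realType) d (u : 'rV[R]_d) : dotp u u = 0 -> u = 0.
Proof.
move=> /eqP; rewrite psumr_eq0 => [/allP u0|i _]; last first.
  by rewrite -expr2 sqr_ge0.
apply/rowP => i; have := u0 i (mem_index_enum _).
by rewrite mulf_eq0 orbb mxE => /eqP.
Qed.

Lemma enorm_ge0 (R : realType) d (u : 'rV[R]_d) : 0 <= enorm u.
Proof. exact: sqrtr_ge0. Qed.

Lemma sqr_enorm (R : realType) d (u : 'rV[R]_d) : enorm u ^+ 2 = dotp u u.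
Proof. by rewrite sqr_sqrtr// dotp_ge0. Qed.

Lemma enorm_eq0 (R : realType) d (u : 'rV[R]_d) : enorm u = 0 -> u = 0.
Proof. by move=> u0; apply: dotp_eq0; rewrite -sqr_enorm u0 expr0n. Qed.

Lemma enorm0 (R : realType) d : enorm (0 : 'rV[R]_d) = 0.
Proof.
by rewrite /enorm /dotp big1 ?sqrtr0// => i _; rewrite mxE mul0r.
Qed.

Lemma enormZ (R : realType) d a (u : 'rV[R]_d) : enorm (a *: u) = `|a| * enorm u.
Proof.
by rewrite /enorm dotpZl dotpC dotpZl mulrA -expr2 sqrtrM ?sqr_ge0// sqrtr_sqr.
Qed.

Lemma enormN (R : realType) d (u : 'rV[R]_d) : enorm (- u) = enorm u.
Proof. by rewrite -scaleN1r enormZ normrN1 mul1r. Qed.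

Lemma enorm_distC (R : realType) d (u v : 'rV[R]_d) : enorm (u - v) = enorm (v - u).
Proof. by rewrite -enormN opprB. Qed.

Lemma dotp_le_enorm (R : realType) d (u v : 'rV[R]_d) :
  `|dotp u v| <= enorm u * enorm v.
Proof.
rewrite -ler_sqr ?nnegrE ?mulr_ge0 ?enorm_ge0// exprMn !sqr_enorm real_normK ?num_real//.
have [v0|v0] := eqVneq (dotp v v) 0.
  rewrite (dotp_eq0 v0); have d0 : dotp u 0 = 0.
    by rewrite /dotp big1// => i _; rewrite mxE mulr0.
  by rewrite d0 expr0n mulr_ge0 ?dotp_ge0.
have vgt0 : 0 < dotp v v by rewrite lt_def v0 dotp_ge0.
have := dotp_ge0 (dotp v v *: u - dotp u v *: v).
rewrite dotpBl !dotpZl !dotpBr !(dotpC _ (_ *: _)) !dotpZl (dotpC v u).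
have -> : dotp v v * (dotp v v * dotp u u - dotp u v * dotp u v) -
  dotp u v * (dotp v v * dotp u v - dotp u v * dotp v v) =
  dotp v v * (dotp u u * dotp v v - dotp u v ^+ 2) by ring.
by rewrite pmulr_rge0// subr_ge0.
Qed.

Lemma enormD (R : realType) d (u v : 'rV[R]_d) :
  enorm (u + v) <= enorm u + enorm v.
Proof.
rewrite -ler_sqr ?nnegrE ?addr_ge0 ?enorm_ge0// sqr_enorm.
rewrite dotpDl !(dotpC _ (_ + _)) !dotpDl sqrrD !sqr_enorm (dotpC v u).
have := le_trans (ler_norm _) (dotp_le_enorm u v); lra.
Qed.

Lemma enorm_triangle (R : realType) d (u v w : 'rV[R]_d) :
  enorm (u - w) <= enorm (u - v) + enorm (v - w).
Proof. by rewrite (le_trans _ (enormD _ _))// subrKA. Qed.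

Lemma coord_le_enorm (R : realType) d (u : 'rV[R]_d) i : `|u ord0 i| <= enorm u.
Proof.
rewrite -ler_sqr ?nnegrE ?enorm_ge0// sqr_enorm real_normK ?num_real//.
rewrite /dotp (bigD1 i)//= expr2 lerDl sumr_ge0// => j _.
by rewrite -expr2 sqr_ge0.
Qed.

Lemma enorm_le_coord (R : realType) d (u : 'rV[R]_d) a : 0 <= a ->
  (forall i, `|u ord0 i| <= a) -> enorm u <= d%:R * a.
Proof.
move=> a0 ua; rewrite -ler_sqr ?nnegrE ?mulr_ge0 ?enorm_ge0//.
rewrite sqr_enorm (le_trans (y := \sum_(i < d) a ^+ 2))//.
  apply: ler_sum => i _; rewrite -expr2 -real_normK ?num_real//.
  by rewrite ler_sqr ?nnegrE.
rewrite sumr_const card_ord -[_ *+ d]mulr_natl exprMn ler_wpM2r ?sqr_ge0//.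
by case: (d) => [|n]; [rewrite expr0n|rewrite expr2 ler_peMl// ler1n].
Qed.

(** * Subspaces *)

Lemma dist_subspace_le (R : realType) d (u v : 'rV[R]_d) (V : {vspace 'rV[R]_d}) :
  v \in V -> dist_subspace u V <= enorm (u - v).
Proof.
move=> vV; apply: ge_inf; last by exists v.
by exists 0 => _ [w _ <-]; exact: enorm_ge0.
Qed.

Lemma dist_subspace_ge (R : realType) d (u : 'rV[R]_d) (V : {vspace 'rV[R]_d}) a :
  (forall v, v \in V -> a <= enorm (u - v)) -> a <= dist_subspace u V.
Proof.
move=> h; apply: lb_le_inf; first by exists (enorm (u - 0)), 0 => //=; rewrite mem0v.
by move=> _ [v vV <-]; exact: h.
Qed.

(** A row relation of the matrix whose columns are a basis of V: it exists
    because this matrix has more rows than columns. *)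
Lemma ex_normal (R : realType) d (V : {vspace 'rV[R]_d}) : (\dim V < d)%N ->
  exists2 w : 'rV[R]_d, enorm w = 1 & forall v, v \in V -> dotp v w = 0.
Proof.
move=> Vd.
pose M : 'M[R]_(d, \dim V) := \matrix_(i, j) (vbasis V)`_j ord0 i.
have /rowV0Pn[w wM w0] : kermx M != 0.
  by rewrite -mxrank_eq0 mxrank_ker subn_eq0 -ltnNge (leq_ltn_trans (rank_leq_col _)).
have wn0 : enorm w != 0 by apply: contra_neq w0; exact: enorm_eq0.
exists ((enorm w)^-1 *: w).
  by rewrite enormZ ger0_norm ?invr_ge0 ?enorm_ge0// mulVf.
move=> v vV; rewrite dotpC dotpZl dotpC.
rewrite [v](coord_vbasis vV) /=.
suff bw i : dotp (vbasis V)`_i w = 0.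
  rewrite (_ : dotp _ _ = 0) ?mulr0//.
  elim/big_ind: _ => [|x y x0 y0|i _]; last by rewrite dotpZl bw mulr0.
    by rewrite /dotp big1// => i _; rewrite mxE mul0r.
  by rewrite dotpDl x0 y0 addr0.
have [iV|iV] := ltnP i (\dim V); last first.
  rewrite nth_default ?size_tuple// /dotp big1// => j _; by rewrite mxE mul0r.
move/sub_kermxP : wM => /matrixP/(_ ord0 (Ordinal iV)).
by rewrite !mxE => <-; apply: eq_bigr => j _; rewrite mxE mulrC.
Qed.

(** A subspace of codimension k is, up to the constant 2^k, described by k unit
    normals. This replaces orthogonal projection to the complement of V: the
    normals are bounded vectors, hence can be rounded to finitely many values.
    They are split off one at a time; replacing V by V + <w> costs the term
    |u.w| and a factor 2. *)
Lemma dist_subspace_normals (R : realType) d k (V : {vspace 'rV[R]_d}) :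
  (\dim V + k = d)%N ->
  exists2 w : 'I_k -> 'rV[R]_d, forall l, enorm (w l) = 1 &
    forall u, dist_subspace u V <= 2 ^+ k * \sum_l `|dotp u (w l)|.
Proof.
elim: k V => [|k IH] V dV.
  exists (fun=> 0) => [[]//|u]; rewrite big_ord0 mulr0.
  have -> : V = fullv.
    by apply/eqP; rewrite eqEdim subvf dimvf /dim/= mul1n -(addn0 (\dim V)) dV leqnn.
  by rewrite (le_trans (dist_subspace_le u (memvf u)))// subrr enorm0.
have [|w w1 wV] := @ex_normal R d V; first by lia.
have wnV : w \notin V.
  apply/negP => /wV; rewrite -sqr_enorm w1 expr1n => /eqP.
  by rewrite oner_eq0.
have [|w' w'1 hw'] := IH (V + <[w]>)%VS.
  rewrite dimv_disjoint_sum.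
    rewrite dim_vline; have [w0|_] := eqVneq w 0; last by lia.
    by move: w1; rewrite w0 enorm0 => /esym/eqP; rewrite oner_eq0.
  apply/eqP; rewrite -subv0; apply/subvP => x; rewrite memv_cap => /andP[xV /vlineP[a xa]].
  move: (wV x xV); rewrite xa dotpZl -sqr_enorm w1 expr1n mulr1 => ->.
  by rewrite scale0r mem0v.
pose f (l : 'I_k.+1) := if unlift ord0 l is Some l' then w' l' else w.
exists f => [l|u]; first by rewrite /f; case: unliftP.
rewrite big_ord_recl {1}/f unlift_none.
under eq_bigr => l _ do rewrite /f liftK.
suff : dist_subspace u V <= 2 * dist_subspace u (V + <[w]>)%VS + `|dotp u w|.
  move=> /le_trans; apply; rewrite exprS.
  have := hw' u.
  have e1 : 1 <= 2 ^+ k :> R by rewrite exprn_ege1// ler1n.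
  have a0 := normr_ge0 (dotp u w).
  have : `|dotp u w| <= 2 ^+ k * `|dotp u w| by rewrite ler_peMl.
  move: a0; set p := `|_|; set q := 2 ^+ k; set r := \sum_l _; nra.
rewrite -lerBlDr -ler_pdivrMl//.
(* Replacing v + a w by v costs |a|, and a differs from u.w by at most the
   distance from u to v + a w. *)
apply: dist_subspace_ge => x /memv_addP[v vV [y]].
move=> /vlineP[a ->] ->; rewrite ler_pdivrMl// lerBlDr.
apply: (le_trans (dist_subspace_le u vV)).
have auw : dotp (u - (v + a *: w)) w = dotp u w - a.
  by rewrite dotpBl dotpDl (wV v)// dotpZl -sqr_enorm w1 expr1n mulr1 add0r.
have := dotp_le_enorm (u - (v + a *: w)) w; rewrite auw w1 mulr1 => h.
have := enorm_triangle u (v + a *: w) v.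
rewrite [_ + _ - v]addrC addKr enormZ w1 mulr1.
have : `|a| <= `|dotp u w| + `|dotp u w - a|.
  by rewrite -{1}[a](subKr (dotp u w)) (le_trans (ler_normB _ _)).
lra.
Qed.

(** * Rounding to finitely many values *)

(** The interval [-1, 1] is cut into n equal cells, the right end point being a
    cell of its own. *)
Definition cell (R : realType) (n : nat) (x : R) : 'I_n.+1 :=
  inord (Num.truncn (n%:R * ((x + 1) / 2))).

Definition uncell (R : realType) (n : nat) (j : 'I_n.+1) : R :=
  2 * j%:R / n%:R - 1.

Lemma val_cell (R : realType) n (x : R) : `|x| <= 1 ->
  cell n x = Num.truncn (n%:R * ((x + 1) / 2)) :> nat.
Proof.
move=> /ler_normlP[x1 x2]; rewrite inordK// ltnS.
have h : 0 <= (x + 1) / 2 <= 1 by apply/andP; split; lra.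
have n0 := ler0n R n; move: ((x + 1) / 2) h => t /andP[t0 t1].
by rewrite -ltnS truncn_lt_nat ?mulr_ge0// -natr1; nra.
Qed.

Lemma cell_itv (R : realType) n (x : R) : `|x| <= 1 ->
  (cell n x)%:R <= n%:R * ((x + 1) / 2) < (cell n x)%:R + 1.
Proof.
move=> x1; rewrite val_cell// natr1; apply: truncn_itv.
by move/ler_normlP: x1 => [? ?]; rewrite mulr_ge0//; lra.
Qed.

Lemma uncell_cell (R : realType) n (x : R) : (0 < n)%N -> `|x| <= 1 ->
  `|x - uncell R (cell n x)| <= 2 / n%:R.
Proof.
move=> n0 /cell_itv-/(_ n); rewrite /uncell; set j := (cell n x)%:R => h.
have {}n0 : 0 < n%:R :> R by rewrite ltr0n.
have -> : x - (2 * j / n%:R - 1) = 2 / n%:R * (n%:R * ((x + 1) / 2) - j).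
  by field; rewrite gt_eqF.
have c0 : 0 <= 2 / n%:R :> R by rewrite divr_ge0 ?(ltW n0).
rewrite normrM (ger0_norm c0) ler_piMr//.
by rewrite ger0_norm; lra.
Qed.

Lemma uncell_le1 (R : realType) n (j : 'I_n.+1) : (0 < n)%N -> `|uncell R j| <= 1.
Proof.
move=> n0; have {}n0 : 0 < n%:R :> R by rewrite ltr0n.
have jn : j%:R <= n%:R :> R by rewrite ler_nat -ltnS.
have : 0 <= (j%:R / n%:R : R) <= 1.
  by rewrite divr_ge0 ?(ltW n0)//= ler_pdivrMr// mul1r.
by rewrite /uncell -mulrA ler_norml => /andP[? ?]; apply/andP; split; lra.
Qed.

Lemma cell_eq_close (R : realType) n (x y : R) : (0 < n)%N ->
  `|x| <= 1 -> `|y| <= 1 -> cell n x = cell n y -> `|x - y| <= 2 / n%:R.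
Proof.
move=> n0 x1 y1 xy.
have := cell_itv n x1; have := cell_itv n y1; rewrite xy.
have {}n0 : 0 < n%:R :> R by rewrite ltr0n.
set j := (cell n y)%:R => /andP[h1 h2] /andP[h3 h4].
rewrite ler_pdivlMr// -[X in _ * X](ger0_norm (ltW n0)) -normrM ler_norml; lra.
Qed.

(** Cell indices of nearby points differ by little, so their residues modulo a
    fixed p determine them. This is how the number of cells that are close to
    a given one is bounded independently of n. *)
Lemma cell_modn_eq (R : realType) n p (x y : R) : `|x| <= 1 -> `|y| <= 1 ->
  n%:R * `|x - y| + 2 <= 2 * p%:R ->
  cell n x = cell n y %[mod p] -> cell n x = cell n y.
Proof.
move=> x1 y1 xyp.
have := cell_itv n x1; have := cell_itv n y1.
set i := cell n x; set j := cell n y => /andP[h1 h2] /andP[h3 h4] ij.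
have xy1 := ler_norm (x - y); have xy2 := ler_norm (y - x).
rewrite distrC in xy2; have n0 : 0 <= n%:R :> R by [].
have k1 : (i < j + p)%N by rewrite -(ltr_nat R) natrD; nra.
have k2 : (j < i + p)%N by rewrite -(ltr_nat R) natrD; nra.
apply/val_inj => /=.
move: ij; wlog : i j k1 k2 {h1 h2 h3 h4} / (i <= j)%N => [H ij|].
  by case/orP: (leq_total i j) => ?; [exact: H|symmetry; exact: H].
move=> ilej /eqP; rewrite eq_sym eqn_mod_dvd// => /dvdn_leq.
by lia.
Qed.

(** * Mutually invisible points *)

(** The ball of radius rho around y' is not contained in the cone at y punctured
    by the half cone. The size of the cone is left out: in the application the
    ball lies inside the ball that truncates the cone. *)
Definition unseen (R : realType) d (alpha rho : R) (y y' theta : 'rV[R]_d)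
    (V : {vspace 'rV[R]_d}) :=
  exists2 z, enorm (z - y') <= rho &
    alpha * enorm (z - y) <= dist_subspace (z - y) V \/
    alpha * enorm (z - y) < dotp (z - y) theta.

(** The witness z is within rho of y', so the conditions on z hold for y' with
    an error of order rho; the distance to V is expressed through the
    normals. *)
Lemma unseenP (R : realType) d k (alpha rho : R) (y y' theta : 'rV[R]_d) V
    (w : 'I_k -> 'rV[R]_d) : 0 < alpha <= 1 -> enorm theta = 1 ->
  (forall l, enorm (w l) = 1) ->
  (forall u, dist_subspace u V <= 2 ^+ k * \sum_l `|dotp u (w l)|) ->
  unseen alpha rho y y' theta V ->
  alpha / 2 ^+ k * (enorm (y' - y) - rho) <=
    \sum_l `|dotp (y' - y) (w l)| + k%:R * rho \/
  alpha * enorm (y' - y) - 2 * rho <= dotp (y' - y) theta.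
Proof.
move=> /andP[a0 a1] th1 w1 dV [z zy' zy].
have zyE : z - y = (z - y') + (y' - y) by rewrite subrKA.
have yz : enorm (y' - y) <= enorm (z - y) + rho.
  by have := enorm_triangle y' z y; rewrite (enorm_distC y' z); lra.
case: zy => h; [left|right].
  rewrite mulrAC ler_pdivrMr ?exprn_gt0//.
  apply: (@le_trans _ _ (alpha * enorm (z - y))).
    by rewrite (ler_wpM2l (ltW a0))//; lra.
  rewrite (le_trans h)// (le_trans (dV _))// mulrC ler_wpM2r ?exprn_ge0//.
  have -> : k%:R * rho = \sum_(l < k) rho.
    by rewrite sumr_const card_ord mulr_natl.
  rewrite -big_split/= ler_sum// => l _; rewrite zyE (dotpDl (z - y')).
  rewrite (le_trans (ler_normD _ _))// [leRHS]addrC lerD2r.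
  by rewrite (le_trans (dotp_le_enorm _ _))// w1 mulr1.
move: h; rewrite {2}zyE (dotpDl (z - y')) => h.
have : dotp (z - y') theta <= rho.
  rewrite (le_trans (ler_norm _))// (le_trans (dotp_le_enorm _ _))//.
  by rewrite th1 mulr1.
have := enorm_ge0 (z - y'); nra.
Qed.

Lemma dotp_le_coord (R : realType) d (u v : 'rV[R]_d) e : 0 <= e ->
  (forall i, `|v ord0 i| <= e) -> `|dotp u v| <= enorm u * (d%:R * e).
Proof.
move=> e0 ve; rewrite (le_trans (dotp_le_enorm _ _))// ler_wpM2l ?enorm_ge0//.
exact: enorm_le_coord.
Qed.

(** If y' is outside the cone at y, the difference u has a large component along
    some normal w l; if its components along the rounded normals w' l are small,
    then u itself is small. *)
Lemma slab_close (R : realType) d k (beta rho e : R) (u : 'rV[R]_d)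
    (w w' : 'I_k -> 'rV[R]_d) : 0 < beta -> 0 <= e ->
  beta * (enorm u - rho) <= \sum_l `|dotp u (w l)| + k%:R * rho ->
  (forall l i, `|(w l - w' l) ord0 i| <= e) ->
  (forall l, `|dotp u (w' l)| <= rho) ->
  2 * (k%:R * d%:R * e) <= beta ->
  enorm u <= (4 * k%:R / beta + 2) * rho.
Proof.
move=> b0 e0 h ww' uw' eb.
suff : \sum_l `|dotp u (w l)| <= k%:R * rho + enorm u * (k%:R * d%:R * e).
  move: h eb (enorm_ge0 u); set S := \sum_l _; set U := enorm u.
  set q := k%:R * d%:R * e => h eb U0 hS.
  have : beta * U <= beta * ((4 * k%:R / beta + 2) * rho).
    have -> : beta * ((4 * k%:R / beta + 2) * rho) =
      (4 * k%:R + 2 * beta) * rho by field; rewrite gt_eqF.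
    nra.
  by rewrite ler_pM2l.
apply: (@le_trans _ _ (\sum_(l < k) (rho + enorm u * (d%:R * e)))); last first.
  rewrite sumr_const card_ord -[_ *+ k]mulr_natl mulrDr lerD2l.
  by rewrite mulrCA !mulrA.
apply: ler_sum => l _; rewrite -[w l](subrK (w' l)) dotpC dotpDl.
rewrite (le_trans (ler_normD _ _))// addrC lerD//; first by rewrite dotpC.
by rewrite dotpC; exact: dotp_le_coord.
Qed.

(** Two points at a large distance are not each in the half cone of the other
    when the two axes are nearly equal: adding the two inequalities bounds
    2 alpha |u| - 4 rho by the scalar product of u with theta - theta'. *)
Lemma opposite_half_cones_close (R : realType) d (alpha rho e : R)
    (u theta theta' : 'rV[R]_d) : 0 < alpha -> 0 <= e ->
  alpha * enorm u - 2 * rho <= dotp u theta ->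
  alpha * enorm u - 2 * rho <= dotp (- u) theta' ->
  (forall i, `|(theta - theta') ord0 i| <= e) ->
  d%:R * e <= alpha ->
  enorm u <= 4 / alpha * rho.
Proof.
move=> a0 e0 h1 h2 tt' ea.
have := le_trans (ler_norm _) (dotp_le_coord u e0 tt').
rewrite dotpBr => h3; rewrite dotpNl in h2.
have U0 := enorm_ge0 u.
have : enorm u * (d%:R * e) <= enorm u * alpha by rewrite ler_wpM2l.
rewrite mulrAC ler_pdivlMr// mulrC; lra.
Qed.

Lemma leq_card_code (I T : finType) (H : {set I}) (code : I -> T) :
  {in H &, injective code} -> (#|H| <= #|T|)%N.
Proof. by move=> /card_in_imset <-; exact: max_card. Qed.

(** Turns the number of codes for k components, each with n m + 1 values, into
    a constant times m^k. *)
Lemma leq_succ_mul_expn n k m : (0 < m)%N ->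
  ((n * m).+1 ^ k <= n.+1 ^ k * m ^ k)%N.
Proof.
move=> m0; rewrite -expnMn; case: (posnP k) => [->|k0]; first by rewrite !expn0.
by rewrite leq_exp2r// mulSn -add1n leq_add2r.
Qed.

(** Pigeonhole on a code of the index i made of the rounded axis, the rounded
    normals, the rounded components of y_i along the rounded normals (with
    step of order rho), and the residues of i. The first three parts of equal
    codes force y_i and y_j to be within M rho, and then the residues give
    i = j. Only the third part has a number of values depending on m, namely
    O(m^k). *)
Lemma few_mutually_unseen (R : realType) d k (alpha : R) : (k < d)%N ->
  0 < alpha <= 1 ->
  exists C : nat, forall (m : nat) (sigma : R) (x0 : 'rV[R]_d)
    (y theta : {ffun 'I_d -> 'I_(2 * m).+1} -> 'rV[R]_d)
    (V : {ffun 'I_d -> 'I_(2 * m).+1} -> {vspace 'rV[R]_d})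
    (H : {set {ffun 'I_d -> 'I_(2 * m).+1}}),
  (0 < m)%N -> 0 < sigma ->
  (forall i, i \in H -> [/\ forall a, `|(y i - x0) ord0 a| <= sigma,
     forall a, i a = cell (2 * m) ((y i - x0) ord0 a / sigma),
     enorm (theta i) = 1 & \dim (V i) = (d - k)%N]) ->
  (forall i j, i \in H -> j \in H -> i != j ->
     unseen alpha (4 * d%:R * sigma / m%:R) (y i) (y j) (theta i) (V i)) ->
  (#|H| <= C * m ^ k)%N.
Proof.
move=> kd alpha01; have /andP[a0 a1] := alpha01.
have d0 : (0 < d)%N by exact: leq_ltn_trans kd.
have dR0 : 0 < d%:R :> R by rewrite ltr0n.
pose beta := alpha / 2 ^+ k.
have b0 : 0 < beta by rewrite divr_gt0 ?exprn_gt0.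
(* Rounding with step 2/N perturbs the scalar products by at most half of the
   lower bounds that the cone and half cone conditions give. *)
pose N := (Num.truncn (4 * d%:R / alpha + 4 * k%:R * d%:R / beta)).+1.
have N0 : 0 < N%:R :> R by rewrite ltr0n.
have NP : 4 * d%:R / alpha + 4 * k%:R * d%:R / beta < N%:R by exact: truncnS_gt.
have Na0 : 0 <= 4 * d%:R / alpha by rewrite divr_ge0 ?mulr_ge0 ?(ltW a0).
have Nb0 : 0 <= 4 * k%:R * d%:R / beta by apply: divr_ge0 (ltW b0); rewrite !mulr_ge0.
have Na : 4 * d%:R <= alpha * N%:R by rewrite [leRHS]mulrC -ler_pdivrMr//; lra.
have Nb : 4 * k%:R * d%:R <= beta * N%:R by rewrite [leRHS]mulrC -ler_pdivrMr//; lra.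
pose M : R := (4 * k%:R / beta + 2) + 4 / alpha.
have M1 : 0 <= 4 * k%:R / beta + 2.
  by apply: addr_ge0 => //; apply: divr_ge0 (ltW b0); rewrite mulr_ge0.
have M2 : 0 <= 4 / alpha by rewrite divr_ge0 ?(ltW a0).
(* Points within M rho = 4 d M sigma / m have cell indices differing by less
   than p. *)
pose p := (Num.truncn (4 * d%:R * M + 1)).+1.
have pP : 4 * d%:R * M + 1 < p%:R by exact: truncnS_gt.
exists ((N.+1 ^ d) * (N.+1 ^ (k * d)) * ((4 * d).+1 ^ k) * (p ^ d))%N.
move=> m sigma x0 y theta V H m0 s0 HP Hun.
have mR0 : 0 < m%:R :> R by rewrite ltr0n.
have [rho rhoE] : exists rho, rho = 4 * d%:R * sigma / m%:R.
  by exists (4 * d%:R * sigma / m%:R).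
rewrite -rhoE in Hun.
have rho0 : 0 < rho by rewrite rhoE divr_gt0 ?mulr_gt0.
have /choice[w wP] i : exists w : 'I_k -> 'rV[R]_d, i \in H ->
    (forall l, enorm (w l) = 1) /\
    forall u, dist_subspace u (V i) <= 2 ^+ k * \sum_l `|dotp u (w l)|.
  have [iH|_] := boolP (i \in H); last by exists (fun=> 0).
  have dV : (\dim (V i) + k = d)%N by case: (HP i iH) => _ _ _ ->; exact: subnK (ltnW kd).
  have [w w1 wV] := dist_subspace_normals dV.
  by exists w.
(* In pr, the scalar products are divided by d m rho, a bound for them, to
   land in [-1, 1]. *)
pose T := ({ffun 'I_d -> 'I_N.+1} * {ffun 'I_k * 'I_d -> 'I_N.+1} *
  {ffun 'I_k -> 'I_(4 * d * m).+1} * {ffun 'I_d -> 'I_p})%type.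
pose wr (f : {ffun 'I_k * 'I_d -> 'I_N.+1}) l : 'rV[R]_d :=
  \row_a uncell R (f (l, a)).
pose wc i : {ffun 'I_k * 'I_d -> 'I_N.+1} :=
  [ffun la : 'I_k * 'I_d => cell N (w i la.1 ord0 la.2)].
pose pr i l := dotp (y i - x0) (wr (wc i) l) / (d%:R * m%:R * rho).
pose code i : T := ([ffun a => cell N (theta i ord0 a)], wc i,
  [ffun l => cell (4 * d * m) (pr i l)], [ffun a => inord (i a %% p)]).
have cardT : (#|{: T}| <= N.+1 ^ d * N.+1 ^ (k * d) * (4 * d).+1 ^ k * p ^ d * m ^ k)%N.
  rewrite /T !card_prod !card_ffun card_prod !card_ord.
  have h := leq_succ_mul_expn (4 * d) k m0.
  apply: leq_trans (leq_mul (leq_mul (leqnn _) h) (leqnn _)) _.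
  by rewrite !mulnA [leqRHS]mulnAC.
apply: leq_trans cardT; apply: (@leq_card_code _ _ _ code) => i j iH jH ij.
apply/eqP/negPn/negP => nij.
have [yi ci ti Vi] := HP i iH; have [yj cj tj Vj] := HP j jH.
have [wi1 wiV] := wP i iH; have [wj1 wjV] := wP j jH.
case: ij => /ffunP et ew /ffunP ep /ffunP em.
have wround i' l : i' \in H -> forall a,
    `|(w i' l - wr (wc i') l) ord0 a| <= 2 / N%:R.
  move=> i'H a; rewrite !mxE ffunE/=; apply: uncell_cell => //.
  by rewrite (le_trans (coord_le_enorm _ _))// (wP i' i'H).1.
have prle i' l : i' \in H -> `|pr i' l| <= 1.
  move=> i'H; have [yi' _ _ _] := HP i' i'H.
  have D0 : 0 < d%:R * m%:R * rho by rewrite !mulr_gt0.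
  rewrite normrM normfV (gtr0_norm D0) ler_pdivrMr// mul1r.
  have wr1 a : `|wr (wc i') l ord0 a| <= 1 by rewrite mxE; exact: uncell_le1.
  rewrite (le_trans (dotp_le_coord _ ler01 wr1))// mulr1.
  have := enorm_le_coord (ltW s0) yi'.
  rewrite (_ : _ * _ * rho = d%:R * (4 * (d%:R * sigma))); last first.
    by rewrite rhoE; field; rewrite gt_eqF.
  have ds0 : 0 < d%:R * sigma by rewrite mulr_gt0.
  by move=> h; rewrite [leLHS]mulrC ler_pM2l//; lra.
have prclose l : `|dotp (y j - y i) (wr (wc i) l)| <= rho.
  have D0 : 0 < d%:R * m%:R * rho by rewrite !mulr_gt0.
  have -> : dotp (y j - y i) (wr (wc i) l) =
      (pr j l - pr i l) * (d%:R * m%:R * rho).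
    rewrite -mulrBl divfK ?gt_eqF// -ew -dotpBl; congr dotp.
    by rewrite opprB addrA subrK.
  have n0 : (0 < 4 * d * m)%N by rewrite !muln_gt0 d0.
  have := cell_eq_close n0 (prle _ l jH) (prle _ l iH).
  have := ep l; rewrite !ffunE => -> /(_ erefl).
  rewrite normrM (gtr0_norm D0) -ler_pdivlMr// => /le_trans; apply.
  rewrite !natrM ler_pdivrMr ?mulr_gt0//.
  rewrite (_ : _ / _ * _ = 4); first by lra.
  by field; rewrite !gt_eqF.
have eN : 0 <= 2 / N%:R :> R by rewrite divr_ge0.
have yij : enorm (y j - y i) <= M * rho.
  have nji : j != i by rewrite eq_sym.
  have ui := unseenP alpha01 ti wi1 wiV (Hun i j iH jH nij).
  have uj := unseenP alpha01 tj wj1 wjV (Hun j i jH iH nji).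
  have kde : 2 * (k%:R * d%:R * (2 / N%:R)) <= beta.
    rewrite (_ : 2 * _ = 4 * k%:R * d%:R / N%:R); last by field; rewrite gt_eqF.
    by rewrite ler_pdivrMr.
  have slab : enorm (y j - y i) <= (4 * k%:R / beta + 2) * rho ->
      enorm (y j - y i) <= M * rho.
    move=> /le_trans; apply; apply: ler_wpM2r; first exact: ltW.
    by rewrite lerDl.
  case: ui => [ui|ui].
    by apply: slab; apply: (slab_close b0 eN ui _ prclose kde) => l; exact: wround.
  case: uj => [uj|uj].
    apply: slab; rewrite enorm_distC.
    apply: (slab_close b0 eN uj _ _ kde) => l; first exact: wround.
    by rewrite -ew -opprB dotpNl normrN; exact: prclose.
  have : enorm (y j - y i) <= 4 / alpha * rho.
    have e0 : 0 <= 4 / N%:R :> R by rewrite divr_ge0.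
    apply: (opposite_half_cones_close (theta' := theta j) a0 e0 ui).
    - by rewrite enorm_distC opprB.
    - move=> a; have := et a; rewrite !ffunE => ta.
      rewrite !mxE (le_trans (cell_eq_close _ _ _ ta))//.
      + by rewrite -ti coord_le_enorm.
      + by rewrite -tj coord_le_enorm.
      + by rewrite ler_pM2r ?invr_gt0//; lra.
    - by rewrite mulrA ler_pdivrMr// mulrC.
  move=> /le_trans; apply; apply: ler_wpM2r; first exact: ltW.
  by rewrite lerDr.
move/negP: nij; apply; apply/eqP/ffunP => a; rewrite ci cj.
have cle i' : i' \in H -> `|(y i' - x0) ord0 a / sigma| <= 1.
  move=> i'H; have [yi' _ _ _] := HP i' i'H.
  by rewrite normrM normfV (gtr0_norm s0) ler_pdivrMr// mul1r.
apply: (@cell_modn_eq R (2 * m) p _ _ (cle i iH) (cle j jH)); last first.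
  have := em a; rewrite !ffunE -ci -cj => /(congr1 (@nat_of_ord _)).
  by rewrite !inordK ?ltn_pmod.
rewrite -mulrBl normrM normfV (gtr0_norm s0).
have -> : (y i - x0) ord0 a - (y j - x0) ord0 a = - (y j - y i) ord0 a.
  by rewrite !mxE; ring.
rewrite normrN natrM.
have : m%:R * (`|(y j - y i) ord0 a| / sigma) <= 4 * d%:R * M.
  rewrite mulrA ler_pdivrMr// -ler_pdivlMl// (le_trans (coord_le_enorm _ _))//.
  rewrite (le_trans yij)// le_eqVlt; apply/orP; left; apply/eqP.
  by rewrite rhoE; field; rewrite gt_eqF.
lra.
Qed.

(** * Ball masses and heavy pieces *)

Lemma outer_measure_le_sum (R : realType) T (mu : {outer_measure set T -> \bar R})
    (I : finType) (F : I -> set T) (A : set T) :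
  (forall x, A x -> exists i, F i x) -> (mu A <= \sum_(i : I) mu (F i))%E.
Proof.
move=> AF.
suff h (r : seq I) : (mu [set x | exists2 i, i \in r & F i x] <=
    \sum_(i <- r) mu (F i))%E.
  apply: le_trans (h _); apply: le_outer_measure => x /AF[i Fi].
  by exists i => //; exact: mem_index_enum.
elim: r => [|i r IH].
  rewrite big_nil (_ : [set _ | _] = set0) ?outer_measure0//.
  by apply/seteqP; split => x // [].
rewrite big_cons; apply: le_trans (leeD2l _ IH).
apply: le_trans (outer_measureU2 _ _ _); apply: le_outer_measure => x [j].
by rewrite inE => /predU1P[->|jr] Fj; [left|right; exists j].
Qed.

Lemma eball_sub (R : realType) d (x y : 'rV[R]_d) r t :
  enorm (x - y) + r <= t -> eball x r `<=` eball y t.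
Proof.
move=> xyr z zx; apply: le_trans xyr.
by rewrite (le_trans (enorm_triangle _ x _))// addrC lerD2l.
Qed.


Lemma bounded_eball (R : realType) d (x : 'rV[R]_d) r : bounded_set (eball x r).
Proof.
exists (enorm x + r); split; first exact: num_real.
move=> M xM y yx /=; apply: le_trans (ltW xM).
have ye : `|y| <= enorm y.
  have [y0|/mx_norm_neq0[[i a]]] := eqVneq (mx_norm y) 0.
    by rewrite [leLHS]y0 enorm_ge0.
  by rewrite (ord1 i) /= => ya; rewrite [leLHS]ya coord_le_enorm.
have := enorm_triangle y x 0; rewrite !subr0; move: yx; rewrite /eball/=; lra.
Qed.

Lemma eball_fin_num (R : realType) d (mu : {outer_measure set 'rV[R]_d -> \bar R})
  x r : is_measure_on_Rd mu -> mu (eball x r) \is a fin_num.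
Proof.
move=> [_ _ muf]; rewrite ge0_fin_numE ?outer_measure_ge0//.
exact/muf/bounded_eball.
Qed.

Definition ball_mass (R : realType) d (mu : {outer_measure set 'rV[R]_d -> \bar R})
  (x : 'rV[R]_d) (r : R) : R := fine (mu (eball x r)).

(** The constant c multiplies the mass of the ball, so that balls of measure 0
    need no separate treatment. *)
Definition avoids_cone (R : realType) d k (alpha c : R)
    (mu : {outer_measure set 'rV[R]_d -> \bar R}) (x : 'rV[R]_d) (r : R) :=
  exists theta V, [/\ enorm theta = 1, \dim V = (d - k)%N &
    (mu (cone x r V alpha `\` half_cone x theta alpha) <=
       c%:E * mu (eball x r))%E].

(** The diameter is coordinatewise, so that cutting into cells divides it by m
    without loss. *)
Definition coord_diam_le (R : realType) d (E : set 'rV[R]_d) (sigma : R) :=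
  forall x y, E x -> E y -> forall a, `|(x - y) ord0 a| <= sigma.

Lemma ball_mass_ge0 (R : realType) d (mu : {outer_measure set 'rV[R]_d -> \bar R})
  x r : 0 <= ball_mass mu x r.
Proof. by rewrite fine_ge0// outer_measure_ge0. Qed.

Lemma ball_massE (R : realType) d (mu : {outer_measure set 'rV[R]_d -> \bar R})
  x r : is_measure_on_Rd mu -> mu (eball x r) = (ball_mass mu x r)%:E.
Proof. by move=> mu_m; rewrite fineK// eball_fin_num. Qed.

Lemma le_ball_mass (R : realType) d (mu : {outer_measure set 'rV[R]_d -> \bar R})
  x y r t : is_measure_on_Rd mu -> enorm (x - y) + r <= t ->
  ball_mass mu x r <= ball_mass mu y t.
Proof.
move=> mu_m xyr; rewrite -lee_fin -!ball_massE//.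
exact/le_outer_measure/eball_sub.
Qed.

(** The ball around y is heavier than the punctured cone, so not a subset of it. *)
Lemma avoids_cone_unseen (R : realType) d (alpha c : R)
    (mu : {outer_measure set 'rV[R]_d -> \bar R}) (x y : 'rV[R]_d) r rho theta V :
  is_measure_on_Rd mu ->
  (mu (cone x r V alpha `\` half_cone x theta alpha) <=
     c%:E * mu (eball x r))%E ->
  eball y rho `<=` eball x r ->
  c * ball_mass mu x r < ball_mass mu y rho ->
  unseen alpha rho x y theta V.
Proof.
move=> mu_m muc yx lt_m; apply: contrapT => nun; move: lt_m; apply/negP; rewrite -leNgt.
rewrite -lee_fin EFinM -!ball_massE//; apply: le_trans muc.
apply: le_outer_measure => z zy; split; first split; first exact: yx.
  by rewrite ltNge; apply/negP => h; apply: nun; exists z => //; left.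
by move=> h; apply: nun; exists z => //; right.
Qed.

Definition piece (R : realType) d m (x0 : 'rV[R]_d) (sigma : R) (E : set 'rV[R]_d)
    (i : {ffun 'I_d -> 'I_(2 * m).+1}) : set 'rV[R]_d :=
  [set x | E x /\ forall a, i a = cell (2 * m) ((x - x0) ord0 a / sigma)].

Lemma ex_piece (R : realType) d m (x0 : 'rV[R]_d) sigma E x : E x ->
  exists i, piece (m := m) x0 sigma E i x.
Proof.
move=> Ex; exists [ffun a => cell (2 * m) ((x - x0) ord0 a / sigma)].
by split => // a; rewrite ffunE.
Qed.

Lemma coord_diam_piece (R : realType) d m (x0 : 'rV[R]_d) sigma E i :
  (0 < m)%N -> 0 < sigma -> E x0 -> coord_diam_le E sigma ->
  coord_diam_le (piece (m := m) x0 sigma E i) (sigma / m%:R).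
Proof.
move=> m0 s0 Ex0 Es x y [Ex ix] [Ey iy] a.
have mR0 : 0 < m%:R :> R by rewrite ltr0n.
have cle z : E z -> `|(z - x0) ord0 a / sigma| <= 1.
  by move=> Ez; rewrite normrM normfV (gtr0_norm s0) ler_pdivrMr// mul1r; exact: Es.
have m20 : (0 < 2 * m)%N by rewrite muln_gt0.
have := cell_eq_close m20 (cle _ Ex) (cle _ Ey); rewrite -ix -iy => /(_ erefl).
rewrite -mulrBl normrM normfV (gtr0_norm s0) ler_pdivrMr//.
have -> : (x - x0) ord0 a - (y - x0) ord0 a = (x - y) ord0 a by rewrite !mxE; ring.
move=> /le_trans; apply; rewrite natrM le_eqVlt; apply/orP; left.
by apply/eqP; field; rewrite gt_eqF.
Qed.

Lemma coord_diam_enorm (R : realType) d E sigma (x y : 'rV[R]_d) : 0 < sigma ->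
  coord_diam_le E sigma -> E x -> E y -> enorm (x - y) <= d%:R * sigma.
Proof. by move=> s0 Es Ex Ey; apply: enorm_le_coord (ltW s0) _; exact: Es. Qed.

(** The radius 3 d sigma of the cones is such that, for m at least 2, the ball of
    radius 4 d sigma / m around y_j lies in the ball of radius 3 d sigma around
    y_i, which in turn lies in the ball of radius 4 d sigma around x0. *)
Lemma few_heavy_pieces (R : realType) d k (alpha : R) : (k < d)%N ->
  0 < alpha <= 1 -> exists C : nat,
  forall (m : nat) (sigma c : R) (mu : {outer_measure set 'rV[R]_d -> \bar R})
    (E : set 'rV[R]_d) (x0 : 'rV[R]_d)
    (y : {ffun 'I_d -> 'I_(2 * m).+1} -> 'rV[R]_d)
    (H : {set {ffun 'I_d -> 'I_(2 * m).+1}}),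
  is_measure_on_Rd mu -> (1 < m)%N -> 0 < sigma -> 0 <= c ->
  E x0 -> coord_diam_le E sigma ->
  (forall x, E x -> avoids_cone k alpha c mu x (3 * d%:R * sigma)) ->
  (forall i, i \in H -> piece x0 sigma E i (y i) /\
     c * ball_mass mu x0 (4 * d%:R * sigma) <
     ball_mass mu (y i) (4 * d%:R * sigma / m%:R)) ->
  (#|H| <= C * m ^ k)%N.
Proof.
move=> kd a01; have [C HC] := few_mutually_unseen kd a01; exists C.
move=> m sigma c mu E x0 y H mu_m m1 s0 c0 Ex0 Es Eav yH.
have m0 : (0 < m)%N by exact: ltnW.
have /choice[tV tVP] i : exists tV : 'rV[R]_d * {vspace 'rV[R]_d}, i \in H ->
  [/\ enorm tV.1 = 1, \dim tV.2 = (d - k)%N &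
    (mu (cone (y i) (3 * d%:R * sigma) tV.2 alpha `\` half_cone (y i) tV.1 alpha) <=
       c%:E * mu (eball (y i) (3 * d%:R * sigma)))%E].
  have [iH|_] := boolP (i \in H); last by exists (0, fullv).
  by have [[Ey _] _] := yH i iH; have [th [V h]] := Eav _ Ey; exists (th, V).
apply: (HC m sigma x0 y (fun i => (tV i).1) (fun i => (tV i).2)) => //.
  move=> i iH; have [[Ey iy] _] := yH i iH; have [t1 V1 _] := tVP i iH.
  by split => // a; exact: Es.
move=> i j iH jH _; have [_ _ muc] := tVP i iH.
have [[Ei _] _] := yH i iH; have [[Ej _] hj] := yH j jH.
have yji := coord_diam_enorm s0 Es Ej Ei.
have yi0 := coord_diam_enorm s0 Es Ei Ex0.
have rm : 4 * d%:R * sigma / m%:R <= 2 * (d%:R * sigma).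
  rewrite ler_pdivrMr ?ltr0n// (_ : 4 * _ * _ = 2 * (d%:R * sigma) * 2); last by ring.
  by rewrite ler_wpM2l ?mulr_ge0 ?(ltW s0)// ler_nat.
apply: (avoids_cone_unseen mu_m muc); first by apply: eball_sub; lra.
apply: le_lt_trans hj; rewrite ler_wpM2l//; apply: le_ball_mass => //; lra.
Qed.

(** * Iterating the subdivision *)

(** Heavy pieces are few and have mass at most w; light pieces are many but have
    mass at most c w. *)
Lemma piece_power_sum (R : realType) d k (alpha : R) : (k < d)%N ->
  0 < alpha <= 1 -> exists C : nat,
  forall (m : nat) (sigma c q : R) (mu : {outer_measure set 'rV[R]_d -> \bar R})
    (E : set 'rV[R]_d) (x0 : 'rV[R]_d)
    (y : {ffun 'I_d -> 'I_(2 * m).+1} -> 'rV[R]_d),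
  is_measure_on_Rd mu -> (1 < m)%N -> 0 < sigma -> 0 <= c -> 0 <= q ->
  E x0 -> coord_diam_le E sigma ->
  (forall x, E x -> avoids_cone k alpha c mu x (3 * d%:R * sigma)) ->
  (forall i, (exists x, piece x0 sigma E i x) -> piece x0 sigma E i (y i)) ->
  \sum_(i | `[< exists x, piece x0 sigma E i x >])
     ball_mass mu (y i) (4 * d%:R * sigma / m%:R) `^ q <=
  ((C * m ^ k)%:R + ((2 * m).+1 ^ d)%:R * c `^ q) *
     ball_mass mu x0 (4 * d%:R * sigma) `^ q.
Proof.
move=> kd a01; have [C HC] := few_heavy_pieces kd a01; exists C.
move=> m sigma c q mu E x0 y mu_m m1 s0 c0 q0 Ex0 Es Eav yP.
have mR0 : 0 < m%:R :> R by rewrite ltr0n ltnW.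
pose P (i : {ffun 'I_d -> 'I_(2 * m).+1}) := `[< exists x, piece x0 sigma E i x >].
have Pin i : P i -> piece x0 sigma E i (y i) by move=> /asboolP; exact: yP.
set w := ball_mass mu x0 _.
pose v i := ball_mass mu (y i) (4 * d%:R * sigma / m%:R).
have w0 : 0 <= w by exact: ball_mass_ge0.
pose H := [set i | P i && (c * w < v i)]%SET.
have HCm : (#|H| <= C * m ^ k)%N.
  apply: (HC m sigma c mu E x0 y H) => // i; rewrite inE => /andP[Pi ?].
  by split => //; exact: Pin.
have vw i : P i -> v i <= w.
  move=> /Pin[Ey _]; apply: le_ball_mass => //.
  have yi0 := coord_diam_enorm s0 Es Ey Ex0.
  have ds0 : 0 <= d%:R * sigma by rewrite mulr_ge0 ?(ltW s0).
  have : 4 * d%:R * sigma / m%:R <= 2 * (d%:R * sigma).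
    rewrite ler_pdivrMr// (_ : 4 * _ * _ = 2 * (d%:R * sigma) * 2); last by ring.
    by rewrite ler_wpM2l ?mulr_ge0 ?(ltW s0)// ler_nat.
  lra.
apply: (@le_trans _ _ (\sum_i ((i \in H)%:R * w `^ q + c `^ q * w `^ q))).
  rewrite [leRHS](bigID P)/= -[leLHS]addr0 lerD//; last first.
    by apply: sumr_ge0 => i _; rewrite addr_ge0 ?mulr_ge0 ?powR_ge0.
  apply: ler_sum => i; rewrite -/(P i) => Pi; rewrite inE Pi/=.
  have [_|vi] := ltP (c * w) (v i).
    rewrite mul1r -[leLHS]addr0 lerD ?mulr_ge0 ?powR_ge0//.
    by apply: ge0_ler_powR; rewrite ?nnegrE ?ball_mass_ge0// vw.
  rewrite mul0r add0r -powRM//.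
  by apply: ge0_ler_powR; rewrite ?nnegrE ?ball_mass_ge0// mulr_ge0.
rewrite big_split/= -mulr_suml sumr_const -natr_sum.
have -> : (\sum_i (i \in H) = #|H|)%N.
  by rewrite -sum1_card [RHS]big_mkcond/=; apply: eq_bigr => i _; case: (i \in H).
rewrite -[(_ * _) *+ _]mulr_natl card_ffun !card_ord mulrA -mulrDl ler_wpM2r ?powR_ge0//.
by rewrite lerD2r ler_nat.
Qed.

Definition sparse_points (R : realType) d (mu : {outer_measure set 'rV[R]_d -> \bar R})
    (E : set 'rV[R]_d) (r lambda : R) :=
  [set x | E x /\ ball_mass mu x r < lambda].

(** Induction on the number j of subdivisions. In the base case a nonempty set S
    of sparse points has measure v smaller than lambda and at most the mass of
    the ball at x0, and v = v^(1-q) v^q. *)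
Lemma sparse_points_le (R : realType) d k (alpha : R) : (k < d)%N ->
  0 < alpha <= 1 -> exists C : nat,
  forall (m : nat) (c q : R) (mu : {outer_measure set 'rV[R]_d -> \bar R}),
  is_measure_on_Rd mu -> (1 < m)%N -> 0 <= c -> 0 < q < 1 ->
  forall (j : nat) (sigma lambda : R) (E : set 'rV[R]_d) (x0 : 'rV[R]_d),
  0 < sigma -> E x0 -> coord_diam_le E sigma ->
  (forall x r, E x -> 0 < r <= 3 * d%:R * sigma -> avoids_cone k alpha c mu x r) ->
  (mu (sparse_points mu E (4 * d%:R * sigma / m%:R ^+ j) lambda) <=
   (lambda `^ (1 - q) * ((C * m ^ k)%:R + ((2 * m).+1 ^ d)%:R * c `^ q) ^+ j *
     ball_mass mu x0 (4 * d%:R * sigma) `^ q)%:E)%E.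
Proof.
move=> kd a01; have [C HC] := piece_power_sum kd a01; exists C.
have d0 : 0 < d%:R :> R by rewrite ltr0n; exact: leq_ltn_trans kd.
move=> m c q mu mu_m m1 c0 /andP[q0 q1]; have m0 : (0 < m)%N by exact: ltnW.
have mR0 : 0 < m%:R :> R by rewrite ltr0n.
set K := (_ + _ * _).
have K0 : 0 <= K by rewrite addr_ge0// mulr_ge0// powR_ge0.
elim=> [|j IH] sigma lambda E x0 s0 Ex0 Es Eav.
  rewrite expr0 divr1 mulr1; set S := sparse_points _ _ _ _.
  have [->|/set0P[x [Ex xl]]] := eqVneq S set0.
    by rewrite outer_measure0 lee_fin mulr_ge0 ?powR_ge0.
  have Sball z : E z -> S `<=` eball z (4 * d%:R * sigma).
    move=> Ez t [Et _]; rewrite /eball/= (le_trans (coord_diam_enorm s0 Es Et Ez))//.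
    by rewrite -mulrA ler_peMl ?mulr_ge0 ?(ltW s0)// ler1n.
  have Sz z : E z -> (mu S <= (ball_mass mu z (4 * d%:R * sigma))%:E)%E.
    by move=> Ez; rewrite -ball_massE//; apply/le_outer_measure/Sball.
  have muS0 : (0 <= mu S)%E by exact: outer_measure_ge0.
  have := Sz _ Ex; have := Sz _ Ex0; case: (mu S) muS0 => // v.
  rewrite !lee_fin => v0 vx0 vx.
  have -> : v = v `^ (1 - q) * v `^ q.
    by rewrite -powRD ?subrK ?powRr1// oner_eq0.
  apply: ler_pM; rewrite ?powR_ge0//; apply: ge0_ler_powR; rewrite ?nnegrE ?ball_mass_ge0//.
  - by rewrite subr_ge0 ltW.
  - exact: le_trans (ball_mass_ge0 _ _ _) (ltW xl).
  - exact: le_trans vx (ltW xl).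
  - exact: ltW.
have /choice[y yP] i : exists y, (exists x, piece (m := m) x0 sigma E i x) ->
    piece x0 sigma E i y.
  have [[y yi]|] := pselect (exists x, piece (m := m) x0 sigma E i x); first by exists y.
  by exists x0.
set S := sparse_points _ _ _ _.
pose F i : set 'rV[R]_d := [set x | piece (m := m) x0 sigma E i x /\
  ball_mass mu x (4 * d%:R * (sigma / m%:R) / m%:R ^+ j) < lambda].
have SF x : S x -> exists i, F i x.
  move=> [Ex xl]; have [i xi] := ex_piece m x0 sigma Ex; exists i; split => //.
  by move: xl; rewrite exprS invfM !mulrA.
apply: le_trans (outer_measure_le_sum mu SF) _.
have sm : 0 < sigma / m%:R by rewrite divr_gt0.
have muF i : (mu (F i) <= (if `[< exists x, piece (m := m) x0 sigma E i x >] then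
    lambda `^ (1 - q) * K ^+ j * ball_mass mu (y i) (4 * d%:R * sigma / m%:R) `^ q
    else 0)%:E)%E.
  case: asboolP => [ne|e]; last first.
    rewrite (_ : F i = set0) ?outer_measure0//.
    by apply/seteqP; split => // x [xi _]; apply: e; exists x.
  rewrite -[4 * d%:R * sigma / _]mulrA; apply: IH => //; first exact: yP.
    exact: coord_diam_piece.
  move=> x r [Ex _] /andP[r0 r1]; apply: Eav => //; rewrite r0 (le_trans r1)//.
  rewrite ler_wpM2l ?mulr_ge0 ?(ltW d0)// ler_pdivrMr// ler_peMr ?(ltW s0)//.
  by rewrite ler1n.
apply: le_trans (lee_sum _ (fun i _ => muF i)) _.
rewrite sumEFin lee_fin -big_mkcond/= -mulr_sumr exprSr mulrA -[leRHS]mulrA.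
rewrite ler_wpM2l ?mulr_ge0 ?powR_ge0 ?exprn_ge0//.
apply: HC => //; first exact: ltW.
move=> x Ex; apply: Eav => //; rewrite lexx andbT.
by rewrite !mulr_gt0.
Qed.

(** * Null sets and limits superior *)

(** The Borel-Cantelli lemma for an outer measure and geometric bounds. *)
Lemma geometric_lim_sup_null (R : realType) T
    (mu : {outer_measure set T -> \bar R}) (F : nat -> set T) (A : set T)
    (b kappa : R) : 0 <= b -> 0 <= kappa < 1 ->
  (forall j, mu (F j) <= (b * kappa ^+ j)%:E)%E ->
  (forall x, A x -> forall J, exists2 j, (J <= j)%N & F j x) ->
  mu A = 0%E.
Proof.
move=> b0 /andP[k0 k1] muF AF.
have geo n : \sum_(i < n) kappa ^+ i <= (1 - kappa)^-1.
  rewrite -[leRHS]mul1r ler_pdivlMr ?subr_gt0// mulrC.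
  rewrite -opprB mulNr -subrX1 opprB gerBl exprn_ge0//.
have tail J : (mu A <= (b / (1 - kappa) * kappa ^+ J)%:E)%E.
  have : (mu A <= mu (\bigcup_i F (J + i)%N))%E.
    apply: le_outer_measure => x /AF-/(_ J)[j Jj Fj].
    by exists (j - J)%N => //; rewrite subnKC.
  move=> /le_trans; apply.
  apply: le_trans (outer_measure_sigma_subadditive mu (fun i => F (J + i)%N)) _.
  apply: lime_le; first by apply: is_cvg_nneseries => i _ _; exact: outer_measure_ge0.
  apply: nearW => n; apply: (@le_trans _ _ (\sum_(0 <= i < n) (b * kappa ^+ (J + i))%:E)%E).
    by apply: lee_sum => i _; exact: muF.
  rewrite sumEFin lee_fin big_mkord.
  under eq_bigr => i _ do rewrite exprD mulrA.
  by rewrite -mulr_sumr [leRHS]mulrAC ler_wpM2l ?mulr_ge0 ?exprn_ge0//.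
apply/eqP; rewrite eq_le outer_measure_ge0 andbT.
apply/lee_addgt0Pr => e e0; rewrite add0e.
have D0 : 0 <= b / (1 - kappa) by rewrite divr_ge0// subr_ge0 ltW.
have : (b / (1 - kappa) * kappa ^+ J) @[J --> \oo] --> b / (1 - kappa) * 0.
  by apply: cvgMr; apply: cvg_expr; rewrite ger0_norm.
rewrite mulr0 => /cvgr0_norm_le/(_ e e0)[J _ /(_ J (leqnn J))].
rewrite /= (ger0_norm (mulr_ge0 D0 (exprn_ge0 _ k0))) => h.
by rewrite (le_trans (tail J))// lee_fin.
Qed.

Lemma outer_measure_bigcup_null (R : realType) T
    (mu : {outer_measure set T -> \bar R}) (F : nat -> set T) :
  (forall i, mu (F i) = 0%E) -> mu (\bigcup_i F i) = 0%E.
Proof.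
move=> F0; apply/eqP; rewrite eq_le outer_measure_ge0 andbT.
apply: le_trans (outer_measure_sigma_subadditive mu F) _.
by rewrite eseries0// => i _ _; exact: F0.
Qed.

Definition decays_often (R : realType) d (mu : {outer_measure set 'rV[R]_d -> \bar R})
    (s : R) (x : 'rV[R]_d) :=
  forall delta, 0 < delta -> exists2 r, 0 < r < delta & ball_mass mu x r < r `^ s.

(** For small r one has ln r < 0, so mu(B(x,r)) >= r^s bounds the quotient of
    logarithms by s. *)
Lemma upper_local_dim_decays (R : realType) d
    (mu : {outer_measure set 'rV[R]_d -> \bar R}) s x : is_measure_on_Rd mu ->
  (s%:E < upper_local_dim mu x)%E -> decays_often mu s x.
Proof.
move=> mu_m + delta delta0; apply: contraPP => nex.
apply/negP; rewrite -leNgt /upper_local_dim limf_esupE.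
have rE r : 0 < r -> r < delta -> r < 1 -> (lne (mu (eball x r)) / (ln r)%:E <= s%:E)%E.
  move=> r0 rd r1; have : r `^ s <= ball_mass mu x r.
    rewrite leNgt; apply/negP => h; apply: nex; exists r => //; exact/andP.
  rewrite ball_massE//; set v := ball_mass _ _ _ => rv.
  have v0 : 0 < v by apply: lt_le_trans rv; exact: powR_gt0.
  have lr0 : ln r < 0 by rewrite ln_lt0// r0 r1.
  rewrite lne_EFin// inver lt_eqF// -EFinM lee_fin ler_ndivrMr//.
  by rewrite -ln_powR ler_ln// ?posrE// powR_gt0.
apply: (@le_trans _ _ (ereal_sup [set (lne (mu (eball x r)) / (ln r)%:E)%E |
    r in [set r | 0 < r < Num.min delta 1]])).
  apply: ereal_inf_lbound; exists [set r | 0 < r < Num.min delta 1] => //.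
  near=> r; rewrite /=; apply/andP; split; near: r.
    exact: nbhs_right_gt.
  by apply: nbhs_right_lt; rewrite lt_min delta0 ltr01.
apply: ge_ereal_sup => y [r /= /andP[r0]]; rewrite lt_min => /andP[rd r1] <-.
exact: rE.
Unshelve. all: by end_near. Qed.

(** The constant has to be enlarged from c to c', because a limsup at most c only
    makes the function smaller than every c' > c near 0. *)
Lemma small_cone_limsup (R : realType) d k (alpha c c' : R)
    (mu : {outer_measure set 'rV[R]_d -> \bar R}) x : is_measure_on_Rd mu ->
  c < c' ->
  (limf_esup (fun r : R =>
           ereal_inf [set cone_ratio mu x alpha r theta V |
                        theta in @unit_sphere R d &
                        V in @grassmannian R d (d - k)])
           0^'+ <= c%:E)%E ->
  exists2 delta, 0 < delta & forall r, 0 < r < delta -> avoids_cone k alpha c' mu x r.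
Proof.
move=> mu_m cc'; rewrite limf_esupE => /le_lt_trans/(_ (_ : (c%:E < c'%:E)%E)).
rewrite lte_fin => /(_ cc') /ereal_inf_lt[_ [A A0 <-] supA].
have [delta /= delta0 hd] : \forall r \near 0^'+, A r by exact: A0.
exists delta => // r /andP[r0 rd].
have Ar : A r by apply: hd => //=; rewrite sub0r normrN gtr0_norm.
have := le_lt_trans (ereal_sup_ubound (imageP _ Ar)) supA.
move=> /ereal_inf_lt[_ [theta th1 [V Vd <-]] ratio].
exists theta, V; split => //; move: ratio; rewrite /cone_ratio.
set S := cone _ _ _ _ `\` _ => ratio.
have SB : (mu S <= mu (eball x r))%E by apply: le_outer_measure => y [[]].
move: ratio SB; rewrite ball_massE//; set v := ball_mass _ _ _.
have muS0 : (0 <= mu S)%E by exact: outer_measure_ge0.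
have [->|v0] := eqVneq v 0.
  by move=> _ /le_trans; apply; rewrite mule0.
have vgt0 : 0 < v by rewrite lt_def v0 ball_mass_ge0.
move=> + _; rewrite inver (negbTE v0) -EFinM; case: (mu S) muS0 => // [t|] _.
  rewrite -EFinM lte_fin lee_fin => h; apply: ltW.
  by rewrite -ltr_pdivrMr.
by rewrite gt0_mulye ?lte_fin ?invr_gt0//.
Qed.

(** * Summing over the scales *)

(** For r with mu(B(x,r)) < r^s, the first j with rho / m^j <= r loses only a
    factor m in the radius. *)
Lemma decays_often_sparse (R : realType) d (mu : {outer_measure set 'rV[R]_d -> \bar R})
    (s rho : R) (m : nat) x : is_measure_on_Rd mu -> 0 < s -> 0 < rho -> (1 < m)%N ->
  decays_often mu s x ->
  forall J, exists2 j, (J <= j)%N &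
    ball_mass mu x (rho / m%:R ^+ j) < (rho * m%:R / m%:R ^+ j) `^ s.
Proof.
move=> mu_m s0 rho0 m1 dec J.
have mR0 : 0 < m%:R :> R by rewrite ltr0n ltnW.
have mX j : 0 < m%:R ^+ j :> R by rewrite exprn_gt0.
have rX j : 0 < rho / m%:R ^+ j by rewrite divr_gt0.
have [r /andP[r0 rJ] rs] := dec _ (rX J).
have exj : exists j, rho / m%:R ^+ j <= r.
  exists (Num.truncn (rho / r)).+1; set n := (Num.truncn _).+1.
  rewrite ler_pdivrMr// -ler_pdivrMl// mulrC.
  apply: le_trans (ltW (truncnS_gt (rho / r))) _.
  by rewrite -natrX ler_nat ltnW// ltn_expl.
case: (ex_minnP exj) => j jr jmin.
have Jj : (J <= j)%N.
  rewrite leqNgt; apply/negP => jJ.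
  suff /le_trans/(_ jr) : rho / m%:R ^+ J <= rho / m%:R ^+ j by rewrite leNgt rJ.
  by rewrite ler_pM2l// lef_pV2 ?posrE// -!natrX ler_nat leq_exp2l// ltnW.
exists j => //.
have rj : r < rho * m%:R / m%:R ^+ j.
  case: j jr jmin Jj => [|j] _ jmin Jj.
    move: Jj rJ; rewrite leqn0 => /eqP ->; rewrite expr0 !divr1 => /lt_le_trans; apply.
    by rewrite ler_peMr ?(ltW rho0)// ler1n ltnW.
  have : ~~ (rho / m%:R ^+ j <= r) by apply/negP => /jmin; rewrite ltnn.
  by rewrite -ltNge exprS invfM mulrA mulfK ?gt_eqF.
apply: (@le_lt_trans _ _ (ball_mass mu x r)).
  by apply: le_ball_mass => //; rewrite subrr enorm0 add0r.
apply: lt_le_trans rs _; apply: ge0_ler_powR; rewrite ?nnegrE; try exact: ltW.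
exact: ltW (lt_trans r0 rj).
Qed.

Lemma powR_exprVn (R : realType) (x p : R) j : 0 <= x ->
  (x ^+ j)^-1 `^ p = (x `^ p)^-1 ^+ j.
Proof.
move=> x0; rewrite -powR_inv1 ?exprn_ge0// -powR_mulrn// -!powRrM -powRN.
by rewrite -powR_mulrn ?powR_ge0// -powRrM; congr powR; ring.
Qed.

(** With s(1-q) = k + g, g > 0, the bound for the j-th set of sparse points is a
    constant times (K / m^(k+g))^j, where K is at most (C + 1) m^k once c is
    chosen to absorb the light pieces; m is then taken with m^g > C + 1. *)
Lemma avoids_decays_null (R : realType) d k (s alpha : R) : (k < d)%N -> k%:R < s ->
  0 < alpha <= 1 -> exists2 c : R, 0 < c &
  forall (mu : {outer_measure set 'rV[R]_d -> \bar R}) (sigma : R) (E : set 'rV[R]_d),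
    is_measure_on_Rd mu -> 0 < sigma -> coord_diam_le E sigma ->
    (forall x r, E x -> 0 < r <= 3 * d%:R * sigma -> avoids_cone k alpha c mu x r) ->
    (forall x, E x -> decays_often mu s x) ->
    mu E = 0%E.
Proof.
move=> kd ks a01; have [C HC] := sparse_points_le kd a01.
have s0 : 0 < s by exact: le_lt_trans ks.
have k0 : 0 <= k%:R :> R by [].
pose q := (s - k%:R) / (2 * s).
have q01 : 0 < q < 1.
  by rewrite divr_gt0 ?subr_gt0 ?mulr_gt0//= ltr_pdivrMr ?mulr_gt0//; lra.
have /andP[q0 q1] := q01.
pose g := (s - k%:R) / 2.
have g0 : 0 < g by rewrite divr_gt0 ?subr_gt0.
have sqE : s * (1 - q) = k%:R + g by rewrite /q /g; field; rewrite gt_eqF.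
have [m m1 mg] : exists2 m, (1 < m)%N & C.+1%:R < m%:R `^ g :> R.
  pose y : R := C.+1%:R `^ g^-1; exists (Num.truncn y).+2 => //.
  have -> : C.+1%:R = y `^ g by rewrite -powRrM mulVf ?lt0r_neq0// powRr1.
  apply: (gt0_ltr_powR g0); rewrite ?nnegrE ?powR_ge0//.
  by rewrite (lt_trans (truncnS_gt _))// ltr_nat.
have mR0 : 0 < m%:R :> R by rewrite ltr0n ltnW.
pose D : R := ((2 * m).+1 ^ d)%:R.
have D0 : 0 < D by rewrite ltr0n expn_gt0.
(* With this c, the light pieces contribute D c^q = 1. *)
pose c := D^-1 `^ q^-1.
have c0 : 0 < c by rewrite powR_gt0// invr_gt0.
have cq : c `^ q = D^-1.
  by rewrite -powRrM mulVf ?gt_eqF// powRr1// invr_ge0 ltW.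
exists c => // mu sigma E mu_m sig0 Es Eav Edec.
have [->|/set0P[x0 Ex0]] := eqVneq E set0; first exact: outer_measure0.
have d0 : 0 < d%:R :> R by rewrite ltr0n; exact: leq_ltn_trans kd.
pose rho := 4 * d%:R * sigma.
have rho0 : 0 < rho by rewrite !mulr_gt0.
have rm0 : 0 < rho * m%:R by rewrite mulr_gt0.
pose lambda j : R := (rho * m%:R / m%:R ^+ j) `^ s.
pose K : R := (C * m ^ k)%:R + D * c `^ q.
have K0 : 0 <= K by rewrite addr_ge0// mulr_ge0 ?powR_ge0// ltW.
have KC : K <= C.+1%:R * m%:R `^ k%:R.
  rewrite /K cq mulfV ?gt_eqF// powR_mulrn ?ler0n// -natrX -natrM natr1 ler_nat.
  by rewrite mulSn -add1n leq_add2r expn_gt0 (ltnW m1).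
pose M : R := (rho * m%:R) `^ (s * (1 - q)).
pose kappa := K / m%:R `^ (s * (1 - q)).
have mp0 : 0 < m%:R `^ (s * (1 - q)) :> R by exact: powR_gt0.
have kappa01 : 0 <= kappa < 1.
  apply/andP; split; first exact: divr_ge0 K0 (ltW mp0).
  rewrite ltr_pdivrMr// mul1r sqE.
  rewrite powRD; last by rewrite (gt_eqF mR0) implybT.
  apply: le_lt_trans KC _; rewrite mulrC ltr_pM2l// powR_gt0//.
apply: (@geometric_lim_sup_null _ _ mu
   (fun j => sparse_points mu E (rho / m%:R ^+ j) (lambda j)) E
   (M * ball_mass mu x0 rho `^ q) kappa) => //.
- by rewrite mulr_ge0 ?powR_ge0.
- move=> j.
  have := HC m c q mu mu_m m1 (ltW c0) q01 j sigma (lambda j) E x0 sig0 Ex0 Es Eav.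
  move=> /le_trans; apply.
  rewrite lee_fin le_eqVlt; apply/orP; left; apply/eqP.
  rewrite -/D -/K -/rho /kappa /lambda -powRrM.
  rewrite powRM ?invr_ge0 ?exprn_ge0 ?(ltW mR0) ?(ltW rm0)//.
  rewrite -/M.
  rewrite powR_exprVn ?(ltW mR0)//.
  by rewrite [in RHS]exprMn; ring.
- move=> x Ex J.
  have [j Jj sj] := decays_often_sparse mu_m s0 rho0 m1 (Edec x Ex) J.
  by exists j.
Qed.

Theorem theorem4p1 (R : realType) (d k : nat) (s alpha : R)
    (k_lt_d : (k < d)%N) (k_lt_s : k%:R < s) (alpha_bnd : 0 < alpha <= 1) :
  exists2 c : R, 0 < c &
    forall mu : {outer_measure set 'rV[R]_d -> \bar R},
      is_measure_on_Rd mu ->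
      almost_all mu (fun x =>
        (s%:E < upper_local_dim mu x)%E ->
        (c%:E < limf_esup (fun r : R =>
           ereal_inf [set cone_ratio mu x alpha r theta V |
                        theta in @unit_sphere R d &
                        V in @grassmannian R d (d - k)])
           0^'+)%E).
Proof.
have [c c0 Hc] := avoids_decays_null k_lt_d k_lt_s alpha_bnd.
exists (c / 2) => [|mu mu_m]; first by rewrite divr_gt0.
have d0 : 0 < d%:R :> R by rewrite ltr0n; exact: leq_ltn_trans k_lt_d.
pose sigma n : R := n.+1%:R^-1.
have sig0 n : 0 < sigma n by rewrite invr_gt0.
(* Points at which the hypotheses hold below a scale of order sigma n, split
   into countably many grid cubes of side sigma n. *)
pose cube n (x : 'rV[R]_d) : {ffun 'I_d -> int} := [ffun a => Num.floor (x ord0 a / sigma n)].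
pose E n l : set 'rV[R]_d := [set x | [/\ pickle (cube n x) = l,
  decays_often mu s x &
  forall r, 0 < r <= 3 * d%:R * sigma n -> avoids_cone k alpha c mu x r]].
have E0 n l : mu (E n l) = 0%E.
  apply: (Hc mu (sigma n)) => //; last first.
  - by move=> x [].
  - by move=> x r [_ _]; apply.
  - move=> x y [xl _ _] [yl _ _] a.
    have /(pcan_inj pickleK)/ffunP/(_ a) : pickle (cube n x) = pickle (cube n y).
      by rewrite xl yl.
    rewrite !ffunE => xy.
    have := floor_itv (x ord0 a / sigma n).
    have := floor_itv (y ord0 a / sigma n); rewrite xy.
    set z := Num.floor _; rewrite intrD => /andP[y1 y2] /andP[x1 x2].
    have : `|x ord0 a / sigma n - y ord0 a / sigma n| <= 1.
      by rewrite ler_norml; apply/andP; split; lra.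
    by rewrite -mulrBl normrM normfV (gtr0_norm (sig0 n)) ler_pdivrMr// mul1r !mxE.
rewrite /almost_all; apply/eqP; rewrite eq_le outer_measure_ge0 andbT.
rewrite -(outer_measure_bigcup_null (fun n => outer_measure_bigcup_null (E0 n))).
apply: le_outer_measure => x /= /not_implyP[dimx]; move=> /negP; rewrite -leNgt => lim.
have cc : c / 2 < c by lra.
have [delta delta0 av] := small_cone_limsup mu_m cc lim.
pose n := Num.truncn (3 * d%:R / delta).
exists n => //; exists (pickle (cube n x)) => //; split => //.
  exact: upper_local_dim_decays.
move=> r /andP[r0 rn]; apply: av; rewrite r0 (le_lt_trans rn)//.
by rewrite /sigma ltr_pdivrMr// [ltRHS]mulrC -ltr_pdivrMr// truncnS_gt.
Qed.
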